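(* Let the knot vector $\tilde{\mathbf{U}}=\{u_0,\dots,u_m\}$ be a strictly increasing sequence, and let $\mathbf{C}$ be the $p$th-degree NURBS curve on $[u_i,u_{i+1}]$ with control points $\mathbf{p}_{i-p},\dots,\mathbf{p}_i$ and weights $\omega_{i-p},\dots,\omega_i$. Suppose the weights $\boldsymbol{\omega}_{\mathbf{j}_0}=\{\omega_j\}_{j\in\mathbf{j}_0}$ tend to $+\infty$ along an approach path with dominant index set $\mathbf{j}_0$ and constants $k_j>0$ ($j\in\mathbf{j}_0$), where $i-p\notin\mathbf{j}_0$ and $i\notin\mathbf{j}_0$. Then the NURBS curve is uniformly convergent on $[u_i,u_{i+1}]$, and the limit curve is $$\lim_{\boldsymbol{\omega}_{\mathbf{j}_0}\to\infty}\mathbf{C}(u)=\frac{\sum_{j\in\mathbf{j}_0}N_{j,p}(u)\,k_j\,\mathbf{p}_j}{\sum_{j\in\mathbf{j}_0}N_{j,p}(u)\,k_j},\qquad u\in[u_i,u_{i+1}].$$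
   Context: Let $p\ge 1$ be the degree and $p\le i\le m-p-1$. The B-spline basis functions are defined by $N_{j,0}(u)=1$ if $u_j\le u<u_{j+1}$ and $0$ otherwise, and $N_{j,p}(u)=\frac{u-u_j}{u_{j+p}-u_j}N_{j,p-1}(u)+\frac{u_{j+p+1}-u}{u_{j+p+1}-u_{j+1}}N_{j+1,p-1}(u)$. On the closed interval $[u_i,u_{i+1}]$ the value of $N_{j,p}$ at $u_{i+1}$ is taken as the limit from the left. With control points $\mathbf{p}_j\in\mathbb{R}^d$ and weights $\omega_j>0$, the $p$th-degree NURBS curve on $[u_i,u_{i+1}]$ is $$\mathbf{C}(u)=\frac{\sum_{j=i-p}^{i}N_{j,p}(u)\,\omega_j\,\mathbf{p}_j}{\sum_{j=i-p}^{i}N_{j,p}(u)\,\omega_j},\qquad u\in[u_i,u_{i+1}].$$ Approach path with dominant index set $\mathbf{j}_0$: the weights are functions $\omega_j=\omega_j(t)>0$ of a real parameter $t\to+\infty$, and $\mathbf{j}_0\subseteq\{i-p,\dots,i\}$ is a nonempty set of indices such that, with $\lambda(t)=\min_{j\in\mathbf{j}_0}\omega_j(t)$, one has $\lambda(t)\to+\infty$; $\omega_j(t)/\lambda(t)\to k_j$ with $0<k_j<\infty$ for each $j\in\mathbf{j}_0$ (these weights have the same order of magnitude); and $\omega_j(t)/\lambda(t)\to 0$ for each $j\in\{i-p,\dots,i\}\setminus\mathbf{j}_0$ (the other weights are negligible). The limit $\boldsymbol{\omega}_{\mathbf{j}_0}\to\infty$ means $t\to+\infty$. The control points and knots do not depend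 on $t$. *)

(* Defs.v *)
From HB Require Import structures.
From mathcomp Require Import all_boot all_order all_algebra finmap.
From mathcomp Require Import all_classical all_reals all_analysis.
Set Implicit Arguments.
Unset Strict Implicit.
Unset Printing Implicit Defensive.
Import Order.TTheory GRing.Theory Num.Theory.
Import numFieldNormedType.Exports.
Local Open Scope classical_set_scope.
Local Open Scope ring_scope.

Fixpoint bspline (R : realType) (u : seq R) (p j : nat) (x : R) : R :=
  match p with
  | 0 => if u`_j <= x < u`_j.+1 then 1 else 0
  | q.+1 =>
      (x - u`_j) / (u`_(j + p) - u`_j) * bspline u q j x
    + (u`_(j + p + 1) - x) / (u`_(j + p + 1) - u`_j.+1) * bspline u q j.+1 x
  end.

(* The half-open convention in degree 0 makes [bspline] right-continuous; on
   the closed span [u_i, u_(i+1)] the right endpoint gets the left limit. *)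
Definition bspline_span (R : realType) (u : seq R) (p i j : nat) (x : R) : R :=
  if x == u`_i.+1 then lim (bspline u p j y @[y --> x^'-])
  else bspline u p j x.

Definition nurbs (R : realType) (d : nat) (u : seq R) (p i : nat)
    (P : nat -> 'rV[R]_d) (w : nat -> R) (x : R) : 'rV[R]_d :=
  (\sum_(i - p <= j < i.+1) bspline_span u p i j x * w j)^-1
  *: \sum_(i - p <= j < i.+1) (bspline_span u p i j x * w j) *: P j.

(* The initial value of the iterated minimum is a weight indexed by an element
   of [j0], so this is the minimum over [j0] whenever [j0] is nonempty. *)
Definition min_weight (R : realType) (j0 : {fset nat}) (w : nat -> R) : R :=
  \big[Num.min/w (head 0%N j0)]_(j <- j0) w j.

Record approach_path (R : realType) (p i : nat) (j0 : {fset nat})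
    (k : nat -> R) (w : nat -> R -> R) : Prop := ApproachPath {
  weight_gt0 : forall j t, (i - p <= j <= i)%N -> 0 < w j t ;
  dominant_sub : forall j, j \in j0 -> (i - p <= j <= i)%N ;
  dominant_neq0 : j0 != fset0 ;
  min_weight_cvgy :
    min_weight j0 (w ^~ t) @[t --> +oo] --> +oo ;
  const_gt0 : forall j, j \in j0 -> 0 < k j ;
  dominant_cvg : forall j, j \in j0 ->
    w j t / min_weight j0 (w ^~ t) @[t --> +oo] --> k j ;
  negligible_cvg : forall j, (i - p <= j <= i)%N -> j \notin j0 ->
    w j t / min_weight j0 (w ^~ t) @[t --> +oo] --> 0 }.

Definition limit_curve (R : realType) (d : nat) (u : seq R) (p i : nat)
    (P : nat -> 'rV[R]_d) (j0 : {fset nat}) (k : nat -> R) (x : R) : 'rV[R]_d :=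
  (\sum_(j <- j0) bspline_span u p i j x * k j)^-1
  *: \sum_(j <- j0) (bspline_span u p i j x * k j) *: P j.

(* Main.v *)
Require Import Defs.
From HB Require Import structures.
From mathcomp Require Import all_boot all_order all_algebra finmap.
From mathcomp Require Import all_classical all_reals all_analysis.
From mathcomp Require Import zify.
Set Implicit Arguments.
Unset Strict Implicit.
Unset Printing Implicit Defensive.
Import Order.TTheory GRing.Theory Num.Theory.
Import numFieldNormedType.Exports.
Local Open Scope classical_set_scope.
Local Open Scope ring_scope.

(** A rational curve depends on its weights only up to a common factor, so the
weights w_j(t), which blow up, may be replaced by the ratios w_j(t) / lambda(t),
where lambda(t) is the least dominant weight.  These ratios converge: to k_j
for the dominant indices and to 0 for the others.  The limit curve is the
rational curve over all of i-p, ..., i with these limit weights, so the theorem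
is a statement of continuous dependence of a rational curve on its weights.

Convergence is locally uniform in the parameter as soon as the limit
denominator does not vanish: the quotient converges jointly, as the
parameter tends to x and t to infinity.  Compactness of [u_i, u_(i+1)] then
makes it uniform ([rational_curve_uniform_cvg]).

It remains to understand the basis functions on the closed span.  On
[u_i, u_(i+1)[ the function N_(j,p) coincides with a polynomial,
[bspline_piece], and the convention of taking the left limit at u_(i+1) says
exactly that the coincidence extends to the closed span
([bspline_span_pieceE]).  For p > 0, among i-p, ..., i the only basis functions
that vanish somewhere on the closed span are N_(i,p), at u_i, and N_(i-p,p), at u_(i+1)
([bspline_piece_gt0]).  Excluding i-p and i from the dominant set therefore
keeps the limit denominator positive, endpoints included. *)

(** * Rational curves and their dependence on the weights *)

Definition rational_curve (R : realType) (X : Type) (d : nat)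
    (I : eqType) (r : seq I) (B : I -> X -> R) (P : I -> 'rV[R]_d)
    (w : I -> R) (x : X) : 'rV[R]_d :=
  (\sum_(j <- r) B j x * w j)^-1 *: \sum_(j <- r) (B j x * w j) *: P j.

Lemma rational_curveZ (R : realType) (X : Type) (d : nat)
    (I : eqType) (r : seq I) (B : I -> X -> R) (P : I -> 'rV[R]_d)
    (w : I -> R) (c : R) (x : X) :
  c != 0 ->
  rational_curve r B P (fun j => w j / c) x = rational_curve r B P w x.
Proof.
move=> c0; rewrite /rational_curve.
under eq_bigr do rewrite mulrA.
under [in X in _ *: X]eq_bigr do rewrite mulrA mulrC -scalerA.
by rewrite -mulr_suml -scaler_sumr scalerA invfM invrK mulfK.
Qed.

Lemma eq_rational_curve (R : realType) (X : Type) (d : nat)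
    (I : eqType) (r : seq I) (B B' : I -> X -> R) (P : I -> 'rV[R]_d)
    (w : I -> R) (x : X) :
  {in r, forall j, B j x = B' j x} ->
  rational_curve r B P w x = rational_curve r B' P w x.
Proof.
move=> BB'; rewrite /rational_curve; congr (_^-1 *: _).
  by apply: eq_big_seq => j /BB' ->.
by apply: eq_big_seq => j /BB' ->.
Qed.

Lemma cvg_weighted_mean (R : realType) (d : nat) (T : Type) (F : set_system T)
    (I : eqType) (r : seq I) (a : I -> T -> R) (b : I -> R)
    (P : I -> 'rV[R]_d) :
  Filter F -> {in r, forall j, a j z @[z --> F] --> b j} ->
  \sum_(j <- r) b j != 0 ->
  (\sum_(j <- r) a j z)^-1 *: (\sum_(j <- r) a j z *: P j) @[z --> F] -->
  (\sum_(j <- r) b j)^-1 *: \sum_(j <- r) b j *: P j.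
Proof.
move=> FF ab b0; apply: cvgZ.
  apply: cvgV => //; rewrite big_seq; under eq_fun do rewrite big_seq.
  by apply: cvg_big => //; exact: add_continuous.
rewrite big_seq; under eq_fun do rewrite big_seq.
apply: cvg_big => //; first exact: add_continuous.
by move=> j jr; apply: cvgZr_tmp; exact: ab.
Qed.

(** Compactness reduces the uniform statement to its local form, where the
parameter and the weights vary together; there it is plain algebra of
limits.  The conclusion is the unfolded form of uniform convergence, in which
the curves are only evaluated on [K]. *)
Lemma rational_curve_uniform_cvg (R : realType) (X : topologicalType)
    (K : set X) (d : nat) (T : Type) (F : set_system T) (I : eqType) (r : seq I)
    (B : I -> X -> R) (P : I -> 'rV[R]_d)
    (v : I -> T -> R) (k : I -> R) :
  Filter F -> compact K ->
  {in r, forall j, continuous (B j)} ->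
  {in r, forall j, v j t @[t --> F] --> k j} ->
  (forall x, K x -> \sum_(j <- r) B j x * k j != 0) ->
  forall E, entourage E -> \forall t \near F, forall x, K x ->
    E (rational_curve r B P k x, rational_curve r B P (v ^~ t) x).
Proof.
move=> FF cK cB vk D0 E entE.
have /compact_near_coveringP/(_ T F (fun t x =>
  E (rational_curve r B P k x, rational_curve r B P (v ^~ t) x)) FF) := cK.
move=> /(_ _)/filterS; apply; first by move=> t Et x Kx; exact: Et.
move=> x Kx.
(* The limit curve also has to be followed as its parameter moves towards x. *)
have limk : rational_curve r B P k z.1 @[z --> filter_prod (nbhs x) F] -->
    rational_curve r B P k x.
  apply: cvg_weighted_mean (D0 _ Kx) => j jr; apply: cvgMr_tmp.
  by apply: cvg_comp; [exact: cvg_fst | exact: cB].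
have limv :
    rational_curve r B P (v ^~ z.2) z.1 @[z --> filter_prod (nbhs x) F] -->
    rational_curve r B P k x.
  apply: cvg_weighted_mean (D0 _ Kx) => j jr; apply: cvgM.
    by apply: cvg_comp; [exact: cvg_fst | exact: cB].
  by apply: cvg_comp; [exact: cvg_snd | exact: vk].
have entE2 := entourage_split_ent entE.
move/cvg_app_entourageP: limk => /(_ _ (entourage_inv entE2)) h1.
move/cvg_app_entourageP: limv => /(_ _ entE2) h2.
near=> z; apply: (entourage_split (rational_curve r B P k x)) => //.
  by near: z; apply: h1.
by near: z; apply: h2.
Unshelve. all: by end_near. Qed.

(** * B-splines on one knot span *)

Section Piece.
Variables (R : realType) (u : seq R) (i : nat).
Hypotheses (u_sorted : sorted <%R u) (i_lt : (i.+1 < size u)%N).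

(** The Cox-de Boor recursion started from the constants 0 and 1 that the
degree-0 splines take on the [i]-th span: the polynomial that agrees with
[bspline u p j] there. *)
Fixpoint bspline_piece (p j : nat) (x : R) : R :=
  match p with
  | 0 => (j == i)%:R
  | q.+1 =>
      (x - u`_j) / (u`_(j + p) - u`_j) * bspline_piece q j x
    + (u`_(j + p + 1) - x) / (u`_(j + p + 1) - u`_j.+1) * bspline_piece q j.+1 x
  end.

Lemma knot_lt (a b : nat) : (a < b)%N -> (b < size u)%N -> u`_a < u`_b.
Proof.
move=> ab bu; apply: (sorted_ltn_nth lt_trans) => //.
by rewrite inE (ltn_trans ab).
Qed.

Lemma knot_le (a b : nat) : (a <= b)%N -> (b < size u)%N -> u`_a <= u`_b.
Proof. by rewrite leq_eqVlt => /predU1P[->//|ab] /(knot_lt ab)/ltW. Qed.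

Lemma bspline_piece_continuous (p j : nat) : continuous (bspline_piece p j).
Proof.
elim: p j => [|q IH] j x /=; first exact: cvg_cst.
apply: cvgD; apply: cvgM; try exact: IH.
  by apply: cvgMr_tmp; apply: cvgB; [exact: cvg_id | exact: cvg_cst].
by apply: cvgMr_tmp; apply: cvgB; [exact: cvg_cst | exact: cvg_id].
Qed.

Lemma bspline_pieceE (p j : nat) (x : R) : (j + p + 1 < size u)%N ->
  u`_i <= x < u`_i.+1 -> bspline u p j x = bspline_piece p j x.
Proof.
move=> + /andP[ix xi]; elim: p j => [|q IH] j ju /=; last first.
  by rewrite !IH//; lia.
have [ji|ij|->] := ltngtP j i; last by rewrite ix xi.
- rewrite [x < _]ltNge (le_trans (knot_le ji _) ix) ?andbF//; lia.
- rewrite [_ <= x]leNgt (lt_le_trans xi (knot_le ij _))//; lia.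
Qed.

(** The left limit at the right endpoint is the value of the polynomial, by
continuity: just to the left of it the spline and the polynomial agree. *)
Lemma bspline_span_pieceE (p j : nat) (x : R) : (j + p + 1 < size u)%N ->
  u`_i <= x <= u`_i.+1 -> bspline_span u p i j x = bspline_piece p j x.
Proof.
move=> ju /andP[ix xi]; rewrite /bspline_span.
have [->|xi'] := eqVneq; last by rewrite bspline_pieceE// ix lt_neqAle xi' xi.
apply/cvg_lim => //.
have: bspline_piece p j y @[y --> u`_i.+1^'-] --> bspline_piece p j u`_i.+1.
  by apply: cvg_at_left_filter; exact: bspline_piece_continuous.
apply: cvg_trans; apply: near_eq_cvg; near=> y.
rewrite bspline_pieceE//; apply/andP; split; near: y.
  by apply: nbhs_left_ge; exact: knot_lt.
exact: nbhs_left_lt.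
Unshelve. all: by end_near. Qed.

Lemma bspline_piece_eq0 (p j : nat) (x : R) : ~~ (j <= i <= j + p)%N ->
  bspline_piece p j x = 0.
Proof.
elim: p j => [|q IH] j ji /=.
  by case: eqVneq ji => // ->; rewrite addn0 leqnn.
by rewrite !IH ?mulr0 ?addr0//; apply: contra ji; lia.
Qed.

(** A linear factor of the recursion can be negative on the span only when it
multiplies a lower-degree spline that is zero there. *)
Lemma bspline_piece_rec_ge0 (p j : nat) (x : R) : (j + p.+1 + 1 < size u)%N ->
  u`_i <= x <= u`_i.+1 ->
  0 <= bspline_piece p j x -> 0 <= bspline_piece p j.+1 x ->
  0 <= (x - u`_j) / (u`_(j + p.+1) - u`_j) * bspline_piece p j x /\
  0 <= (u`_(j + p.+1 + 1) - x) / (u`_(j + p.+1 + 1) - u`_j.+1)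
         * bspline_piece p j.+1 x.
Proof.
move=> ju /andP[ix xi] L0 L1; split.
  have [ji|ij] := leqP j i; last first.
    by rewrite (bspline_piece_eq0 (p := p)) ?mulr0//; lia.
  rewrite mulr_ge0// divr_ge0// subr_ge0.
    by rewrite (le_trans _ ix)// knot_le//; lia.
  by rewrite knot_le//; lia.
have [ji|ij] := leqP i (j + p.+1); last first.
  by rewrite (bspline_piece_eq0 (p := p)) ?mulr0//; lia.
rewrite mulr_ge0// divr_ge0// subr_ge0.
  by rewrite (le_trans xi)// knot_le//; lia.
by rewrite knot_le//; lia.
Qed.

Lemma bspline_piece_ge0 (p j : nat) (x : R) : (j + p + 1 < size u)%N ->
  u`_i <= x <= u`_i.+1 -> 0 <= bspline_piece p j x.
Proof.
move=> + xi; elim: p j => [|q IH] j ju /=; first by rewrite ler0n.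
have [||h1 h2] := bspline_piece_rec_ge0 ju xi; try by apply: IH; lia.
exact: addr_ge0.
Qed.

(** The two disjunctions exclude exactly the zeros on the closed span: for
positive degree, the last index [j = i] at the left endpoint and the first
index [j = i - p] at the right one.  In degree 0 the piece is the constant 1,
whence the alternative [p == 0].  In the induction one of the two summands is
always positive, but which one depends on [j] and [x]. *)
Lemma bspline_piece_gt0 (p j : nat) (x : R) : (j + p + 1 < size u)%N ->
  u`_i <= x <= u`_i.+1 -> (j <= i <= j + p)%N ->
  [|| p == 0%N, (j < i)%N | u`_i < x] ->
  [|| p == 0%N, (i < j + p)%N | x < u`_i.+1] ->
  0 < bspline_piece p j x.
Proof.
move=> + xi; elim: p j => [|q IH] j ju /= ji c1 c2.
  by have -> : j == i; [lia | rewrite ltr01].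
have [||h1 h2] := bspline_piece_rec_ge0 ju xi;
  try by apply: bspline_piece_ge0 => //; lia.
have /andP[ix xi'] := xi.
have left_gt0 : 0 < bspline_piece q j x ->
    0 < (x - u`_j) / (u`_(j + q.+1) - u`_j) * bspline_piece q j x.
  move=> L; rewrite mulr_gt0// divr_gt0// subr_gt0; last by apply: knot_lt; lia.
  have /orP[ji'|] := c1; first by rewrite (lt_le_trans (knot_lt ji' _))//; lia.
  by apply: le_lt_trans; apply: knot_le; lia.
have right_gt0 : 0 < bspline_piece q j.+1 x ->
    0 < (u`_(j + q.+1 + 1) - x) / (u`_(j + q.+1 + 1) - u`_j.+1)
      * bspline_piece q j.+1 x.
  move=> L; rewrite mulr_gt0// divr_gt0// subr_gt0; last by apply: knot_lt; lia.
  have /orP[ji'|] := c2; first by rewrite (le_lt_trans xi')// knot_lt//; lia.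
  by move/lt_le_trans; apply; apply: knot_le; lia.
have [xlt|xeq] := boolP [|| q == 0%N, (i < j + q)%N | x < u`_i.+1].
  have [ijq|ijq] := leqP i (j + q).
    apply: ltr_wpDr => //; apply: left_gt0; apply: IH => //; try lia.
    by rewrite c1 orbT.
  apply: ltr_wpDl => //; apply: right_gt0; apply: IH => //; try lia.
(* Here x = u_(i+1) and j + q = i: the lower-degree spline of index j vanishes
   at this endpoint, so the second summand has to be used. *)
move: xeq; rewrite !negb_or -leNgt => /and3P[q0 iq xge].
have {}c2 : (i < j + q.+1)%N by move: c2; rewrite ltNge xge orbF.
apply: ltr_wpDl => //; apply: right_gt0; apply: IH => //; try lia.
by rewrite (lt_le_trans _ xge) ?orbT// knot_lt.
Qed.

End Piece.

(** * The limit of the curve *)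

Lemma min_weight_gt0 (R : realType) (j0 : {fset nat}) (w : nat -> R) :
  j0 != fset0 -> {in j0, forall j, 0 < w j} -> 0 < min_weight j0 w.
Proof.
move=> j00 w0; rewrite /min_weight big_seq.
have h0 : (head 0%N j0 \in j0).
  have [j] := fset0Pn _ j00.
  change (j \in enum_fset j0 -> head 0%N j0 \in enum_fset j0).
  by case: (enum_fset j0) => //= a s _; exact: mem_head.
apply: (big_ind (fun y => 0 < y)) => [|x y x0 y0|j /w0//]; first exact: w0.
by rewrite lt_min x0.
Qed.

Theorem theorem3 (R : realType) (d m p i : nat) (u : m.+1.-tuple R)
    (P : nat -> 'rV[R]_d) (j0 : {fset nat}) (k : nat -> R) (w : nat -> R -> R) :
  (1 <= p)%N -> (p <= i <= m - p - 1)%N ->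
  sorted <%R u ->
  approach_path p i j0 k w ->
  (i - p)%N \notin j0 -> i \notin j0 ->
  {uniform `[u`_i, u`_i.+1],
    (fun t : R => nurbs u p i P (w ^~ t)) @ +oo --> limit_curve u p i P j0 k}.
Proof.
move=> p1 pim su [w0 j0sub j00 _ k0 vk vk0] ipj0 ij0.
have szu : size u = m.+1 by rewrite size_tuple.
pose r := index_iota (i - p) i.+1.
(* The limits of the normalized weights over the whole index range. *)
pose kk j := if j \in j0 then k j else 0.
pose L := bspline_piece u i p.
pose mw t := min_weight j0 (w ^~ t).
have mw_gt0 t : 0 < mw t.
  by apply: min_weight_gt0 => // j jj0; apply: w0; exact: j0sub.
have rP j : j \in r = (i - p <= j <= i)%N by rewrite mem_index_iota.
have spanE j x : j \in r -> u`_i <= x <= u`_i.+1 ->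
    bspline_span u p i j x = L j x.
  by rewrite rP => jr xi; apply: bspline_span_pieceE => //; lia.
have L_ge0 j x : j \in r -> u`_i <= x <= u`_i.+1 -> 0 <= L j x.
  by rewrite rP => jr xi; apply: bspline_piece_ge0 => //; lia.
have L_gt0 j x : j \in j0 -> u`_i <= x <= u`_i.+1 -> 0 < L j x.
  move=> jj0 xi; have jr := j0sub _ jj0.
  have ji : j != i by apply: contraNneq ij0 => <-.
  have jip : j != (i - p)%N by apply: contraNneq ipj0 => <-.
  by apply: bspline_piece_gt0 => //; lia.
have sum_j0 (V : zmodType) (f : nat -> V) :
    \sum_(j <- j0) f j = \sum_(j <- r) (if j \in j0 then f j else 0).
  rewrite -big_mkcond -[RHS]big_filter; apply: perm_big.
  apply: uniq_perm; [exact: fset_uniq | exact/filter_uniq/iota_uniq |].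
  move=> j; rewrite mem_filter; apply/idP/andP => [jj0|[]//].
  by split=> //; rewrite rP; exact: j0sub.
have limE x : u`_i <= x <= u`_i.+1 ->
    limit_curve u p i P j0 k x = rational_curve r L P kk x.
  move=> xi; rewrite -(eq_rational_curve (B := bspline_span u p i)); last first.
    by move=> j jr; exact: spanE.
  rewrite /limit_curve /rational_curve !sum_j0; congr (_^-1 *: _);
    apply: eq_bigr => j _; rewrite /kk; case: ifP => //; rewrite mulr0//.
  by rewrite scale0r.
have nurbsE t x : u`_i <= x <= u`_i.+1 ->
    nurbs u p i P (w ^~ t) x = rational_curve r L P (fun j => w j t / mw t) x.
  move=> xi; rewrite rational_curveZ ?gt_eqF//.
  rewrite -(eq_rational_curve (B := bspline_span u p i))// => j jr.
  exact: spanE.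
move=> A /uniform_nbhs[E [entE /filterS]]; apply.
have : \forall t \near +oo, forall x, `[u`_i, u`_i.+1]%classic x ->
    E (rational_curve r L P kk x,
       rational_curve r L P (fun j => w j t / mw t) x).
  apply: rational_curve_uniform_cvg => //.
  - exact: segment_compact.
  - by move=> j _; exact: bspline_piece_continuous.
  - move=> j; rewrite rP => jr; rewrite /kk; case: ifPn => jj0.
      exact: vk.
    exact: vk0.
  move=> x; rewrite /= in_itv/= => xi.
  have /fset0Pn[a aj0] := j00.
  rewrite gt_eqF// (big_rem a)/=; last by rewrite rP j0sub.
  rewrite ltr_pwDl//; first by rewrite /kk aj0 mulr_gt0 ?L_gt0 ?k0.
  rewrite big_seq sumr_ge0// => j /mem_rem jr.
  rewrite mulr_ge0 ?L_ge0//.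
  by rewrite /kk; case: ifP => // jj0; rewrite ltW ?k0.
apply: filterS => t Et x /[dup] xi /=; rewrite in_itv/= => xi'.
by rewrite limE// nurbsE//; exact: Et.
Qed.
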